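(* Let $(\Omega, E, \mathbf{C})$ be a causal space. Then the induced belief space of $(\Omega, E, \mathbf{C})$ exists and is unique. That is, let $\mathcal{F} = \sigma(\{E_0, E_1, \ldots, E_N\})$ be the algebra generated by the primitive events. Then there exists exactly one belief function $\mathbf{B}$ over $\mathcal{F} \times \mathcal{F}$ such that $\mathbf{B}(A|B) = \mathbf{C}(A|B)$ for all $(A,B) \in \bigcup_{n=1}^N (\mathcal{E}_n \times \mathcal{A}_{n-1})$.
   Context: Throughout, $\Omega$ is a finite set (of outcomes), and $A^c$ denotes the complement of $A$ in $\Omega$. The symbol $\subset$ denotes non-strict inclusion. An algebra over $\Omega$ is a nonempty set of subsets of $\Omega$ closed under complement and (finite) union. For a set $\mathcal{G}$ of subsets of $\Omega$, $\sigma(\mathcal{G})$ is the smallest algebra over $\Omega$ containing every member of $\mathcal{G}$. An atom set is a partition of $\Omega$, and its members are called atoms. For an algebra $\mathcal{F}$, $\alpha(\mathcal{F})$ is the largest (i.e. finest) atom set consisting of members of $\mathcal{F}$. For an arbitrary set $\mathcal{G}$ of subsets of $\Omega$, write $\alpha(\mathcal{G}) := \alpha(\sigma(\mathcal{G}))$. Primitive events: $E = (E_0, E_1, \ldots, E_N)$ is a finite sequence of subsets of $\Omega$ with $E_0 := \Omega$ and $E_n \notin \sigma(\{E_0, \ldots, E_{n-1}\})$ for all $n \in \{1,\ldots,N\}$. Put $\mathcal{E}_n := \{E_n, E_n^c\}$ and $\mathcal{A}_n := \alpha(\{E_0, E_1, \ldots, E_n\})$. Causal function: for $n \in \{1,\ldots,N\}$,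 an $n$-th causal function is a function $\mathbf{C}_n : \mathcal{E}_n \times \mathcal{A}_{n-1} \to [0,1]$, written $(A,B) \mapsto \mathbf{C}_n(A|B)$, such that for all $A \in \mathcal{E}_n$, $B \in \mathcal{A}_{n-1}$: $\mathbf{C}_n(A|B) = 1$ if $B \subset A$; $\mathbf{C}_n(A|B) = 0$ if $A \cap B = \varnothing$; and $\mathbf{C}_n(A|B) + \mathbf{C}_n(A^c|B) = 1$. A causal function over $E$ is a function $\mathbf{C}$ on $\bigcup_{n=1}^N (\mathcal{E}_n \times \mathcal{A}_{n-1})$ given by $\mathbf{C}(A|B) = \mathbf{C}_n(A|B)$ if $A \in \mathcal{E}_n$, $B \in \mathcal{A}_{n-1}$, where each $\mathbf{C}_n$ is an $n$-th causal function. A causal space is a tuple $(\Omega, E, \mathbf{C})$ with $\Omega$ a set of outcomes, $E$ a sequence of primitive events, and $\mathbf{C}$ a causal function over $E$. Belief function: given an algebra $\mathcal{F}$ over $\Omega$, a set function $\mathbf{B}$ over $\mathcal{F} \times \mathcal{F}$, written $(A,B) \mapsto \mathbf{B}(A|B)$, is a belief function iff (B1) for $A, B \in \mathcal{F}$, $\mathbf{B}(A|B) \in [0,1]$; (B2) for $A, B \in \mathcal{F}$, $\mathbf{B}(A|B) = 1$ if $B \subset A$; (B3) for $A, B \in \mathcal{F}$, $\mathbf{B}(A|B) = 0$ if $A \cap B = \varnothing$; (B4) for $A, B \in \mathcal{F}$, $\mathbf{B}(A|B) + \mathbf{B}(A^c|B) = 1$; (B5) for $A, B, C \in \mathcal{F}$,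 $\mathbf{B}(A \cap B|C) = \mathbf{B}(A|C)\, \mathbf{B}(B|A \cap C)$. A belief space is a tuple $(\Omega, \mathcal{F}, \mathbf{B})$ where $\Omega$ is a set of outcomes, $\mathcal{F}$ is an algebra over $\Omega$ and $\mathbf{B} : \mathcal{F} \times \mathcal{F} \to [0,1]$ is a belief function. Induced belief space: the induced belief space of a causal space $(\Omega, E, \mathbf{C})$ is the belief space $(\Omega, \mathcal{F}, \mathbf{B})$ with (i) $\mathcal{F} = \sigma(\{E_0, E_1, \ldots, E_N\})$ and (ii) $\mathbf{B}(A|B) = \mathbf{C}(A|B)$ for all $(A,B) \in \bigcup_{n=1}^N (\mathcal{E}_n \times \mathcal{A}_{n-1})$.
   Formalization: As stated it is false: (B2) and (B3) clash at B=∅, and uniqueness fails at null events. Here B1–B5 are imposed for nonempty conditioning events only, and uniqueness of B(A|D) is claimed for D contained in some atom H of some A_n (n≤N) with B(D|H)≠0. *)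

(* Defs.v *)
From mathcomp Require Import all_boot all_order all_algebra reals.

Set Implicit Arguments.
Unset Strict Implicit.
Unset Printing Implicit Defensive.

Import Order.TTheory GRing.Theory Num.Theory.
Local Open Scope ring_scope.

Definition is_algebra (T : finType) (F : {set {set T}}) : bool :=
  [&& F != set0,
      [forall A in F, ~: A \in F] &
      [forall A in F, forall B in F, A :|: B \in F]].

(* The intersection is over a nonempty family, since [set: {set T}] is an
   algebra, and is itself an algebra: it is the least one containing G. *)
Definition sigma_gen (T : finType) (G : {set {set T}}) : {set {set T}} :=
  \bigcap_(F : {set {set T}} | is_algebra F && (G \subset F)) F.

Definition is_atom_set (T : finType) (P : {set {set T}}) : bool :=
  partition P [set: T].

Definition is_finest_atom_set (T : finType) (F P : {set {set T}}) : bool :=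
  [&& is_atom_set P, P \subset F &
      [forall Q : {set {set T}}, is_atom_set Q && (Q \subset F) ==>
         [forall A in P, exists B in Q, A \subset B]]].

(* Refinement of partitions is antisymmetric, so at most one P can be picked;
   one exists when F is an algebra, so set0 is only a default outside algebras. *)
Definition atoms_of_algebra (T : finType) (F : {set {set T}}) : {set {set T}} :=
  odflt set0 [pick P | is_finest_atom_set F P].

Definition atoms (T : finType) (G : {set {set T}}) : {set {set T}} :=
  atoms_of_algebra (sigma_gen G).

Definition event (T : finType) (N : nat) (E : N.+1.-tuple {set T}) (n : nat)
  : {set T} := nth set0 E n.

Definition primitive_events (T : finType) (N : nat)
    (E : N.+1.-tuple {set T}) : Prop :=
  event E 0 = [set: T] /\
  forall n, (1 <= n <= N)%N -> event E n \notin sigma_gen [set:: take n E].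

Definition event_pair (T : finType) (N : nat) (E : N.+1.-tuple {set T})
    (n : nat) : {set {set T}} := [set event E n; ~: event E n].

Definition history_atoms (T : finType) (N : nat) (E : N.+1.-tuple {set T})
    (n : nat) : {set {set T}} := atoms [set:: take n.+1 E].

Definition event_algebra (T : finType) (N : nat) (E : N.+1.-tuple {set T})
  : {set {set T}} := sigma_gen [set:: E].

(* Functions of a pair (A, B) are total on {set T}; only their values on the
   domain stated in each definition are constrained.  C A B is C(A|B). *)

Definition nth_causal_function (R : realType) (T : finType) (N : nat)
    (E : N.+1.-tuple {set T}) (n : nat) (C : {set T} -> {set T} -> R) : Prop :=
  forall A B, A \in event_pair E n -> B \in history_atoms E n.-1 ->
    [/\ 0 <= C A B <= 1,
        B \subset A -> C A B = 1,
        A :&: B = set0 -> C A B = 0 &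
        C A B + C (~: A) B = 1].

(* One function C serves for all n: the sets event_pair E n, 1 <= n <= N, are
   pairwise disjoint for primitive events, so the n-th restrictions of C are
   independent of one another. *)
Definition causal_space (R : realType) (T : finType) (N : nat)
    (E : N.+1.-tuple {set T}) (C : {set T} -> {set T} -> R) : Prop :=
  primitive_events E /\
  forall n, (1 <= n <= N)%N -> nth_causal_function E n C.

(* The conditioning event ranges over the nonempty members of F: for an empty
   one, clauses 2 and 3 would give B(A|set0) = 1 and B(A|set0) = 0.  In clause 5
   A :&: D may be empty; then B A D = 0 and both sides vanish by clause 3,
   whatever the value of B outside its domain. *)
Definition belief_function (R : realType) (T : finType) (F : {set {set T}})
    (B : {set T} -> {set T} -> R) : Prop :=
  [/\ forall A D, A \in F -> D \in F -> D != set0 -> 0 <= B A D <= 1,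
      forall A D, A \in F -> D \in F -> D != set0 -> D \subset A -> B A D = 1,
      forall A D, A \in F -> D \in F -> D != set0 -> A :&: D = set0 -> B A D = 0,
      forall A D, A \in F -> D \in F -> D != set0 -> B A D + B (~: A) D = 1 &
      forall A A' D, A \in F -> A' \in F -> D \in F -> D != set0 ->
        B (A :&: A') D = B A D * B A' (A :&: D)].

Definition induced_belief (R : realType) (T : finType) (N : nat)
    (E : N.+1.-tuple {set T}) (C B : {set T} -> {set T} -> R) : Prop :=
  belief_function (event_algebra E) B /\
  forall n A D, (1 <= n <= N)%N ->
    A \in event_pair E n -> D \in history_atoms E n.-1 -> B A D = C A D.

(* D is non-null given some history H.  H = [set: T], the only member of
   history_atoms E 0 when T is inhabited, gives the events of nonzero
   unconditional belief; a proper H admits further events D. *)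
Definition nonnull_given_history (R : realType) (T : finType) (N : nat)
    (E : N.+1.-tuple {set T}) (B : {set T} -> {set T} -> R) (D : {set T}) : Prop :=
  exists n H, [/\ (n <= N)%N, H \in history_atoms E n, D \subset H & B D H != 0].

(* Main.v *)
(** Each [history_atoms E n] consists of the cells of points of [T] under
    membership in [E_0], ..., [E_n], so the atoms form a tree whose branches
    carry the probabilities [C].  Multiplying the branch probabilities below
    depth [n] gives a weight on points with total mass [1] in every node of
    depth [n].  To condition on [D], use the least [n] whose weight does not
    vanish on [D]: such a lexicographic quotient is always a belief function.
    On a node of depth [m >= n] the weights of depths [n] and [m] are
    proportional, hence it extends [C].  Conversely, the axioms determine any
    induced belief given a node by descending induction on the depth, and
    belief given [D] is then forced whenever [D] has nonzero belief given a
    node containing it. *)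
Require Import Defs.
From mathcomp Require Import all_boot all_order all_algebra reals.

Set Implicit Arguments.
Unset Strict Implicit.
Unset Printing Implicit Defensive.

Import Order.TTheory GRing.Theory Num.Theory.
Local Open Scope ring_scope.

(** * Generated algebras and their atoms *)

Section Algebra.
Variable T : finType.
Implicit Types (F G P : {set {set T}}) (A B : {set T}).

Lemma is_algebraP F :
  reflect [/\ F != set0, forall A, A \in F -> ~: A \in F
            & forall A B, A \in F -> B \in F -> A :|: B \in F]
          (is_algebra F).
Proof.
apply: (iffP and3P) => -[F0 FC FU]; split=> //.
- by move=> A; move/forall_inP: FC; apply.
- by move=> A B FA FB; move/forall_inP: FU => /(_ A FA)/forall_inP; apply.
- exact/forall_inP.
- by apply/forall_inP => A FA; apply/forall_inP => B; apply: FU.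
Qed.

Lemma sub_sigma_gen G : G \subset sigma_gen G.
Proof. by apply/bigcapsP => F /andP[]. Qed.

Lemma sigma_gen_sub F G : is_algebra F -> G \subset F -> sigma_gen G \subset F.
Proof. by move=> algF sGF; apply: bigcap_inf; rewrite algF. Qed.

Lemma sigma_genC G A : A \in sigma_gen G -> ~: A \in sigma_gen G.
Proof.
move=> /bigcapP GA; apply/bigcapP => F FG.
by have /andP[/is_algebraP[_ FC _] _] := FG; apply/FC/GA.
Qed.

Lemma sigma_genU G A B :
  A \in sigma_gen G -> B \in sigma_gen G -> A :|: B \in sigma_gen G.
Proof.
move=> /bigcapP GA /bigcapP GB; apply/bigcapP => F FG.
by have /andP[/is_algebraP[_ _ FU] _] := FG; apply: FU; [apply: GA|apply: GB].
Qed.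

Lemma sigma_genI G A B :
  A \in sigma_gen G -> B \in sigma_gen G -> A :&: B \in sigma_gen G.
Proof.
move=> GA GB; rewrite -[A :&: B]setCK setCI.
by apply: sigma_genC; apply: sigma_genU; apply: sigma_genC.
Qed.

Lemma sigma_genT G : [set: T] \in sigma_gen G.
Proof.
apply/bigcapP => F /andP[/is_algebraP[/set0Pn[A FA] FC FU] _].
by rewrite -(setUCr A); apply/FU/FC.
Qed.

(** The class of [x] under agreement on every member of [G]; [atomsE] shows that these classes are
    the atoms of the generated algebra. *)
Definition cell G (x : T) : {set T} :=
  [set y | [forall A in G, (y \in A) == (x \in A)]].

Lemma cellP G x y :
  reflect {in G, forall A, (y \in A) = (x \in A)} (y \in cell G x).
Proof.
by rewrite inE; apply: (iffP forall_inP) => h A GA; apply/eqP; rewrite h.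
Qed.

Lemma cell_refl G x : x \in cell G x.
Proof. exact/cellP. Qed.

Lemma cell_eq G x y : y \in cell G x -> cell G y = cell G x.
Proof.
move=> /cellP xy; apply/setP => z.
by apply/cellP/cellP => h A GA; rewrite h ?xy.
Qed.

Lemma sub_cell G1 G2 x : G1 \subset G2 -> cell G2 x \subset cell G1 x.
Proof.
move=> /subsetP sG; apply/subsetP => y /cellP xy.
by apply/cellP => A /sG; apply: xy.
Qed.

Lemma cellE G x :
  cell G x = \bigcap_(A in G) (if x \in A then A else ~: A).
Proof.
apply/setP => y; apply/cellP/bigcapP => h A GA; have := h A GA.
- by case: ifP => // _; rewrite inE => ->.
- by case: ifP => // _; rewrite inE => /negbTE.
Qed.

Lemma cell_sigma F G x : G \subset sigma_gen F -> cell G x \in sigma_gen F.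
Proof.
move=> /subsetP sGF; rewrite cellE.
elim/big_ind: _ => [|A B|A /sGF FA]; [exact: sigma_genT|exact: sigma_genI|].
by case: ifP => // _; apply: sigma_genC.
Qed.

(** The sets that do not separate [x] from [y] form an algebra; it contains [G] when [x] and [y]
    share a cell. *)
Lemma sigma_gen_saturated G A x y :
  A \in sigma_gen G -> y \in cell G x -> (y \in A) = (x \in A).
Proof.
move=> GA xy; pose F := [set A : {set T} | (y \in A) == (x \in A)].
suff /subsetP/(_ A GA) : sigma_gen G \subset F by rewrite inE => /eqP.
apply: sigma_gen_sub.
  apply/is_algebraP; split.
  - by apply/set0Pn; exists setT; rewrite !inE.
  - by move=> B; rewrite !inE => /eqP ->.
  - by move=> B D; rewrite !inE => /eqP -> /eqP ->.
by apply/subsetP => B GB; rewrite inE; move/cellP: xy => ->.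
Qed.

Definition cells G : {set {set T}} := [set cell G x | x : T].

Lemma cells_partition G : partition (cells G) [set: T].
Proof.
apply/and3P; split.
- apply/eqP/setP => x; rewrite inE; apply/bigcupP.
  by exists (cell G x); rewrite ?cell_refl ?imset_f.
- apply/trivIsetP => _ _ /imsetP[x _ ->] /imsetP[y _ ->]; apply: contraR.
  by case/pred0Pn => z /andP[/= /cell_eq <- /cell_eq <-].
- by apply/imsetP => -[x _ /setP/(_ x)]; rewrite cell_refl inE.
Qed.

Lemma cells_finest G : is_finest_atom_set (sigma_gen G) (cells G).
Proof.
apply/and3P; split; first exact: cells_partition.
  by apply/subsetP => _ /imsetP[x _ ->]; apply/cell_sigma/sub_sigma_gen.
apply/forall_inP => Q /andP[/and3P[/eqP covQ _ _] /subsetP sQ].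
apply/forall_inP => _ /imsetP[x _ ->].
have /bigcupP[B QB xB] : x \in cover Q by rewrite covQ.
apply/exists_inP; exists B => //; apply/subsetP => y.
(* A block of [Q] is saturated, so it contains the cell of each of its points. *)
by move=> /(sigma_gen_saturated (sQ B QB)) ->.
Qed.

Lemma atomsE G : atoms G = cells G.
Proof.
rewrite /atoms /atoms_of_algebra; case: pickP => [P|/(_ (cells G))]; last first.
  by rewrite cells_finest.
move=> /and3P[Patoms /subsetP sP /forall_inP Pfine].
have {Pfine} /forall_inP Pfine : [forall A in P, exists B in cells G, A \subset B].
  by apply: Pfine; have /and3P[-> ->] := cells_finest G.
have {Patoms} /and3P[/eqP covP _ nP0] := Patoms.
(* Fineness of [P] puts its block inside a cell, and saturation gives the reverse inclusion. *)
have PE A x : A \in P -> x \in A -> A = cell G x.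
  move=> PA Ax; apply/eqP; rewrite eqEsubset; apply/andP; split.
    have /exists_inP[_ /imsetP[z _ ->] sAz] := Pfine A PA.
    by rewrite (cell_eq (subsetP sAz x Ax)).
  by apply/subsetP => y /(sigma_gen_saturated (sP A PA)) ->.
apply/setP => A; apply/idP/imsetP => [PA|[x _ ->]].
  have /set0Pn[x Ax] : A != set0 by apply: contraNneq nP0 => <-.
  by exists x => //; apply: PE.
have /bigcupP[B PB xB] : x \in cover P by rewrite covP.
by rewrite -(PE B x).
Qed.

End Algebra.

(** * Lexicographic conditional beliefs *)

Section Lexicographic.
Variables (R : realType) (T : finType) (w : nat -> T -> R) (N : nat).
Implicit Types A D : {set T}.

Definition mass n D : R := \sum_(x in D) w n x.

(* The junk value N.+1 is excluded when w N > 0 and D is nonempty. *)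
Definition level D : nat := find (fun n => mass n D != 0) (iota 0 N.+1).

Definition lex_belief A D : R :=
  mass (level D) (A :&: D) / mass (level D) D.

Lemma mass0 n : mass n set0 = 0.
Proof. by rewrite /mass big_set0. Qed.

Lemma massID n A D : mass n (A :&: D) + mass n (~: A :&: D) = mass n D.
Proof.
by rewrite [RHS](big_setID A) /= setDE ![D :&: _]setIC.
Qed.

Lemma level_le n D : (n <= N)%N -> mass n D != 0 -> (level D <= n)%N.
Proof.
move=> leN Dn; rewrite leqNgt; apply/negP => lt.
by have := before_find 0%N lt; rewrite nth_iota // add0n Dn.
Qed.

Lemma mass_level n D : (n <= N)%N -> mass n D != 0 -> mass (level D) D != 0.
Proof.
move=> leN Dn; have /(nth_find 0%N) : has (fun n => mass n D != 0) (iota 0 N.+1).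
  by apply/hasP; exists n; rewrite // mem_iota.
by rewrite nth_iota // ltnS (leq_trans (level_le leN Dn)).
Qed.

Hypothesis w_ge0 : forall n x, (n <= N)%N -> 0 <= w n x.
Hypothesis wN_gt0 : forall x, 0 < w N x.

(** Strict positivity at depth [N] is what keeps the denominator of [lex_belief] nonzero on nonempty
    events. *)
Lemma massN_neq0 D : D != set0 -> mass N D != 0.
Proof.
case/set0Pn => x Dx; rewrite gt_eqF // /mass (bigD1 x) //=.
by rewrite ltr_pwDl // sumr_ge0 // => y _; apply: w_ge0.
Qed.

Lemma level_leN D : D != set0 -> (level D <= N)%N.
Proof. by move=> D0; apply: level_le; rewrite ?massN_neq0. Qed.

Lemma mass_ge0 n D : (n <= N)%N -> 0 <= mass n D.
Proof. by move=> leN; apply: sumr_ge0 => x _; apply: w_ge0. Qed.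

Lemma le_mass n A D : (n <= N)%N -> A \subset D -> mass n A <= mass n D.
Proof.
by move=> leN sAD; rewrite -(massID n A D) (setIidPl sAD) lerDl mass_ge0.
Qed.

(** Mass is monotone, so a depth that vanishes on [D] also vanishes on [A]: the level of [A] cannot
    be smaller. *)
Lemma level_sub A D : A \subset D -> D != set0 ->
  mass (level D) A != 0 -> level A = level D.
Proof.
move=> sAD D0 A0; have leN := level_leN D0.
apply/eqP; rewrite eqn_leq level_le //= level_le //.
  by rewrite (leq_trans (level_le leN A0)).
apply: contraNneq (mass_level leN A0) => D00.
have leAN : (level A <= N)%N by rewrite (leq_trans (level_le leN A0)).
by rewrite eq_le mass_ge0 // -[leRHS]D00 le_mass.
Qed.

Lemma lex_belief_function (F : {set {set T}}) : belief_function F lex_belief.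
Proof.
have level0 D : D != set0 -> mass (level D) D != 0.
  by move=> D0; apply: mass_level (leqnn N) _; apply: massN_neq0.
split; rewrite /lex_belief.
- move=> A D _ _ D0; have leN := level_leN D0.
  have Dgt0 : 0 < mass (level D) D by rewrite lt0r level0 ?mass_ge0.
  by rewrite divr_ge0 ?mass_ge0 //= ler_pdivrMr // mul1r le_mass ?subsetIr.
- by move=> A D _ _ D0 /setIidPr ->; rewrite divff ?level0.
- by move=> A D _ _ D0 ->; rewrite mass0 mul0r.
- by move=> A D _ _ D0; rewrite -mulrDl massID divff ?level0.
- move=> A A' D _ _ _ D0; set n := level D.
  have leN : (n <= N)%N := level_leN D0.
  (* If this mass vanishes, so does that of the smaller intersection. Otherwise [A :&: D] has the
     level of [D], and its mass cancels in the product. *)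
  have [AD0|AD0] := eqVneq (mass n (A :&: D)) 0.
    rewrite AD0 !mul0r; apply/eqP; rewrite mulf_eq0; apply/orP; left.
    by rewrite eq_le mass_ge0 // andbT -[leRHS]AD0 le_mass // setSI // subsetIl.
  rewrite (level_sub (subsetIr A D) D0 AD0) -/n.
  by rewrite setIA [A' :&: A]setIC [RHS]mulrC mulrA divfK //.
Qed.

End Lexicographic.

(** The law of total probability: two uses of the product rule factor out [B X D], leaving
    complementary beliefs given [X :&: D]. *)
Lemma belief_total (R : realType) (T : finType) (G : {set {set T}})
    (B : {set T} -> {set T} -> R) (X A D : {set T}) :
  belief_function (sigma_gen G) B -> X \in sigma_gen G -> A \in sigma_gen G ->
  D \in sigma_gen G -> D != set0 ->
  B X D = B A D * B X (A :&: D) + B (~: A) D * B X (~: A :&: D).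
Proof.
move=> [_ _ BD0 BC BM] FX FA FD D0; have FAC := sigma_genC FA.
rewrite -!BM // ![_ :&: X]setIC !BM //.
(* Complementary beliefs need a nonempty condition; when [X :&: D] is empty, the factor [B X D]
   vanishes instead. *)
have [XD0|XD0] := eqVneq (X :&: D) set0; first by rewrite (BD0 X D) ?mul0r ?addr0.
by rewrite -mulrDr BC ?mulr1 // sigma_genI.
Qed.

(** * The tree of histories *)

Section Causal.
Variables (R : realType) (T : finType) (N : nat) (E : N.+1.-tuple {set T}).
Variable C : {set T} -> {set T} -> R.
Hypothesis causalC : forall n, (1 <= n <= N)%N -> nth_causal_function E n C.
Implicit Types (n : nat) (A D S X : {set T}) (x : T).

Definition node n x : {set T} := cell [set:: take n.+1 E] x.

Definition side n x : {set T} := if x \in event E n then event E n else ~: event E n.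

(** The division spreads the mass of a leaf evenly over its points, which no event separates. At
    depth [N] the product is empty, so the weight is positive even where [C] vanishes. *)
Definition tree_weight n x : R :=
  (\prod_(n.+1 <= k < N.+1) C (side k x) (node k.-1 x)) / #|node N x|%:R.

Local Notation tmass := (mass tree_weight).

Lemma history_atomsP n A :
  reflect (exists x, A = node n x) (A \in history_atoms E n).
Proof.
rewrite /history_atoms atomsE.
by apply: (iffP imsetP) => [[x _ ->]|[x ->]]; exists x.
Qed.

Lemma node_atom n x : node n x \in history_atoms E n.
Proof. by apply/history_atomsP; exists x. Qed.

Lemma node_neq0 n x : node n x != set0.
Proof. by apply/set0Pn; exists x; apply: cell_refl. Qed.

Lemma node_algebra n x : node n x \in event_algebra E.
Proof.
apply: cell_sigma; apply: subset_trans (sub_sigma_gen _).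
by apply/subsetP => A; rewrite !inE; apply: mem_take.
Qed.

Lemma event_in_algebra n : (n <= N)%N -> event E n \in event_algebra E.
Proof.
move=> leN; apply: (subsetP (sub_sigma_gen _)).
by rewrite inE /event mem_nth // size_tuple.
Qed.

Lemma sub_node m n x : (m <= n)%N -> node n x \subset node m x.
Proof.
move=> lemn; apply: sub_cell; apply/subsetP => A; rewrite !inE.
by rewrite -(@take_takel _ m.+1 n.+1) //; apply: mem_take.
Qed.

Lemma side_pair n x : side n x \in event_pair E n.
Proof. by rewrite /side /event_pair; case: ifP; rewrite !inE eqxx ?orbT. Qed.

Lemma side_eq n A x : A \in event_pair E n -> x \in A -> side n x = A.
Proof.
by case/set2P => ->; rewrite /side ?inE; [move=> ->|case: ifP].
Qed.

Lemma nodeS n x : (n < N)%N -> node n.+1 x = side n.+1 x :&: node n x.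
Proof.
move=> ltN; have tE : take n.+2 E = rcons (take n.+1 E) (event E n.+1).
  by rewrite (take_nth set0) // size_tuple.
apply/setP => y; rewrite in_setI; apply/cellP/andP => [h|[ys /cellP h] A].
  split; last by apply/cellP => A; rewrite inE => EA; apply: h;
    rewrite inE tE mem_rcons inE EA orbT.
  have /h : event E n.+1 \in [set:: take n.+2 E] by rewrite inE tE mem_rcons mem_head.
  by rewrite /side; case: ifP => // _; rewrite inE => ->.
rewrite inE tE mem_rcons inE => /orP[/eqP ->|EA]; last by apply: h; rewrite inE.
by move: ys; rewrite /side; case: ifP => // _; rewrite inE => /negbTE.
Qed.

Lemma tree_weight_ge0 n x : 0 <= tree_weight n x.
Proof.
rewrite /tree_weight divr_ge0 // big_seq prodr_ge0 // => k.
rewrite mem_index_iota => /andP[n_k k_N].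
have k1N : (1 <= k <= N)%N by rewrite (leq_trans _ n_k).
by have [/andP[]] := causalC k1N (side_pair k x) (node_atom k.-1 x).
Qed.

Lemma tree_weightN_gt0 x : 0 < tree_weight N x.
Proof.
by rewrite /tree_weight big_geq // mul1r invr_gt0 ltr0n card_gt0 node_neq0.
Qed.

Lemma tree_weightS n x : (n < N)%N ->
  tree_weight n x = C (side n.+1 x) (node n x) * tree_weight n.+1 x.
Proof. by move=> ltN; rewrite /tree_weight big_ltn // mulrA. Qed.

(** All points in one branch of a node share the single factor by which the weights of depths [n]
    and [n.+1] differ. *)
Lemma massS n A S x : (n < N)%N -> A \in event_pair E n.+1 ->
  S \subset A :&: node n x -> tmass n S = C A (node n x) * tmass n.+1 S.
Proof.
move=> ltN EA /subsetP sS; rewrite /mass mulr_sumr.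
apply: eq_bigr => y /sS /setIP[Ay ny].
by rewrite tree_weightS // (side_eq EA Ay) /node (cell_eq ny).
Qed.

(* If [A :&: node n x] is empty then both sides are [0]. *)
Lemma mass_branch n A x : (n < N)%N ->
  (forall y, tmass n.+1 (node n.+1 y) = 1) -> A \in event_pair E n.+1 ->
  tmass n (A :&: node n x) = C A (node n x).
Proof.
move=> ltN IH EA; have [A0|/set0Pn[y /setIP[Ay ny]]] := eqVneq (A :&: node n x) set0.
  by have [_ _ ->] := causalC (n := n.+1) ltN EA (node_atom n x); rewrite // A0 mass0.
have -> := massS ltN EA (subxx _).
have -> : A :&: node n x = node n.+1 y.
  by rewrite nodeS // (side_eq EA Ay) /node (cell_eq ny).
by rewrite IH mulr1.
Qed.

Lemma mass_node n x : (n <= N)%N -> tmass n (node n x) = 1.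
Proof.
(* Writing [n] as [N - (N - n)] turns descending induction on the depth into induction on the height
   above the leaves. *)
move=> leN; rewrite -(subKn leN); move: (leq_subr n N).
elim: (N - n)%N x => [|k IH] x lekN.
  rewrite subn0 /mass (eq_bigr (fun=> #|node N x|%:R^-1)) => [|y ny].
    by rewrite sumr_const -[LHS]mulr_natl mulfV // pnatr_eq0 -lt0n card_gt0 node_neq0.
  by rewrite /tree_weight big_geq // mul1r /node (cell_eq ny).
set m := (N - k.+1)%N.
have mS : m.+1 = (N - k)%N by rewrite /m subnS prednK // subn_gt0.
have ltN : (m < N)%N by rewrite mS leq_subr.
have IH' y : tmass m.+1 (node m.+1 y) = 1 by rewrite mS IH // ltnW.
have Ep : event E m.+1 \in event_pair E m.+1 by rewrite !inE eqxx.
have EpC : ~: event E m.+1 \in event_pair E m.+1 by rewrite !inE eqxx orbT.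
(* The two branches carry masses [C A (node m x)] for complementary [A], which sum to one. *)
rewrite -(massID _ _ (event E m.+1)) !mass_branch //.
by have [] := causalC (n := m.+1) ltN Ep (node_atom m x).
Qed.

Lemma mass_proportional m n x : (m <= n <= N)%N ->
  exists c, forall S, S \subset node n x -> tmass m S = c * tmass n S.
Proof.
move=> /andP[le_mn le_nN].
(* These are the factors of the weight at depth [m] that are absent at depth [n]; they depend only
   on the node of depth [n]. The constant may be zero. *)
exists (\prod_(m.+1 <= k < n.+1) C (side k x) (node k.-1 x)) => S /subsetP sS.
rewrite /mass mulr_sumr; apply: eq_bigr => y /sS ny.
rewrite /tree_weight (big_cat_nat (n := n.+1)) //= -?mulrA.
congr (_ * _); apply: eq_big_nat => k /andP[m_k k_n].
have nodek j : (j <= n)%N -> node j y = node j x.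
  by move=> le_jn; apply/cell_eq/(subsetP (sub_node x le_jn)).
rewrite nodek ?(leq_trans (leq_pred k)) //; congr (C _ _).
case: k m_k k_n => // k _ k_n; apply: side_eq; first exact: side_pair.
have kN : (k < N)%N by apply: leq_trans le_nN.
have : y \in node k.+1 x by apply: (subsetP (sub_node x _)) ny.
by rewrite nodeS // => /setIP[].
Qed.

Definition tree_belief := lex_belief tree_weight N.

Lemma tree_belief_node n A x : (n <= N)%N ->
  tree_belief A (node n x) = tmass n (A :&: node n x).
Proof.
move=> leN; have n1 : tmass n (node n x) = 1 by apply: mass_node.
have n0 : tmass n (node n x) != 0 by rewrite n1 oner_neq0.
have [|c cE] := @mass_proportional (level tree_weight N (node n x)) n x.
  by rewrite level_le.
(* Since the node has mass one at depth [n], [c] is its mass at its own level, hence nonzero, and it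
   cancels in the quotient. *)
have := mass_level leN n0; rewrite /tree_belief /lex_belief !cE ?subsetIr //.
by rewrite n1 mulr1 => c0; rewrite mulrAC divff // mul1r.
Qed.

Lemma tree_belief_induced : induced_belief E C tree_belief.
Proof.
split.
  apply: lex_belief_function => [n x _|x]; first exact: tree_weight_ge0.
  exact: tree_weightN_gt0.
move=> [//|n] A D /= ltN EA /history_atomsP[x ->].
rewrite tree_belief_node; last exact: ltnW.
by apply: mass_branch => // y; apply: mass_node.
Qed.

(** The right side does not mention [B], so all induced beliefs agree given a node. Above the
    leaves, total belief over the next event reduces the claim to the two branches, weighted by
    [C]. *)
Lemma induced_belief_node B n X x : induced_belief E C B -> (n <= N)%N ->
  X \in event_algebra E -> B X (node n x) = tmass n (X :&: node n x).
Proof.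
move=> [belB BC] leN FX; rewrite -(subKn leN); move: (leq_subr n N).
have [_ B1 B0 _ _] := belB.
elim: (N - n)%N x => [|k IH] x lekN.
  (* A leaf is a cell for the whole of [E], so [X] either contains it or misses it. *)
  rewrite subn0; have nodeX y : y \in node N x -> (y \in X) = (x \in X).
    by rewrite /node take_oversize ?size_tuple //; apply: sigma_gen_saturated.
  have [xX|xX] := boolP (x \in X).
    have sX : node N x \subset X by apply/subsetP => y /nodeX ->.
    by rewrite B1 ?node_algebra ?node_neq0 // (setIidPr sX) mass_node.
  have X0 : X :&: node N x = set0.
    apply/setP => y; rewrite in_setI in_set0; apply/andP => -[+ /nodeX].
    by rewrite (negbTE xX) => ->.
  by rewrite B0 ?node_algebra ?node_neq0 // X0 mass0.
set m := (N - k.+1)%N.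
have mS : m.+1 = (N - k)%N by rewrite /m subnS prednK // subn_gt0.
have ltN : (m < N)%N by rewrite mS leq_subr.
have branch A : A \in event_pair E m.+1 -> A \in event_algebra E ->
    B A (node m x) * B X (A :&: node m x) = tmass m (A :&: (X :&: node m x)).
  move=> EA FA; have [A0|/set0Pn[y /setIP[Ay ny]]] := eqVneq (A :&: node m x) set0.
    (* An empty branch has belief zero, so the value of [B X set0] is irrelevant. *)
    by rewrite B0 ?node_algebra ?node_neq0 // mul0r setICA A0 setI0 mass0.
  have -> := massS ltN EA (setIS A (subsetIr X _)).
  have AE : A :&: node m x = node m.+1 y.
    by rewrite nodeS // (side_eq EA Ay) /node (cell_eq ny).
  by rewrite (BC m.+1) ?node_atom // setICA AE mS IH // ltnW.
have FE : event E m.+1 \in event_algebra E by apply: event_in_algebra.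
rewrite (belief_total belB FX FE (node_algebra m x) (node_neq0 m x)).
rewrite !branch ?massID ?sigma_genC //; by rewrite !inE eqxx ?orbT.
Qed.

End Causal.

Theorem theorem2 (R : realType) (T : finType) (N : nat)
    (E : N.+1.-tuple {set T}) (C : {set T} -> {set T} -> R)
    (hC : causal_space E C) :
  exists B : {set T} -> {set T} -> R,
    induced_belief E C B /\
    forall B' : {set T} -> {set T} -> R, induced_belief E C B' ->
      forall A D : {set T}, A \in event_algebra E -> D \in event_algebra E ->
        nonnull_given_history E B D -> B' A D = B A D.
Proof.
have [_ causalC] := hC; have indB := tree_belief_induced causalC.
exists (tree_belief E C); split=> // B' indB' A D FA FD.
move=> [n [_ [leN /history_atomsP[x ->] sD D0]]].
(* As [D] lies inside the node, the product rule expresses [B A D] as a quotient of beliefs given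
   the node. *)
have BM B : induced_belief E C B ->
    B (D :&: A) (node E n x) = B D (node E n x) * B A D.
  move=> [[_ _ _ _ BM] _].
  by rewrite BM ?node_algebra ?node_neq0 // (setIidPl sD).
have BE X : X \in event_algebra E ->
    B' X (node E n x) = tree_belief E C X (node E n x).
  by move=> FX; rewrite !(induced_belief_node causalC).
(* Both induced beliefs agree given the node, on [D] and on [D :&: A]; the nonzero factor then
   cancels. *)
apply: (mulfI D0); rewrite -(BM _ indB) -(BE D FD) -(BM _ indB') BE //.
exact: sigma_genI.
Qed.
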